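(* Let $G$ be a group and $N$ a normal subgroup of $G$. Then for any non-empty subsets $H_1$ and $H_2$ of $G$ containing $N$ the following hold: (1) $\overline{\operatorname{Apr}}_{G/N}((H_1H_2)/N)\subseteq \overline{\operatorname{Apr}}_{G/N}(H_1/N)\,\overline{\operatorname{Apr}}_{G/N}(H_2/N)$. (2) $\underline{\operatorname{Apr}}_{G/N} (H_1/N)\,\underline{\operatorname{Apr}}_{G/N} (H_2/N)\subseteq \underline{\operatorname{Apr}}_{G/N}((H_1H_2)/N)$.
   Context: Let $G$ be a group (written multiplicatively) and $N$ a normal subgroup of $G$. For a subset $H\subseteq G$ with $N\subseteq H$ (not necessarily a subgroup), $H/N:=\{hN : h\in H\}\subseteq G/N$. The relation $\theta$ on $G/N$ is conjugacy: $xN\,\theta\, yN$ iff $xN=(aya^{-1})N$ for some $a\in G$; the class of $xN$ is $[xN]_\theta=\{(axa^{-1})N : a\in G\}$. For a subset $S\subseteq G/N$, the lower and upper approximations are $\underline{\operatorname{Apr}}_{G/N}(S)=\{xN\in G/N : [xN]_\theta\subseteq S\}$ and $\overline{\operatorname{Apr}}_{G/N}(S)=\{xN\in G/N : [xN]_\theta\cap S\neq\varnothing\}$. Products of subsets of a group are elementwise: $AB=\{ab : a\in A, b\in B\}$, both in $G$ and in $G/N$. *)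

(* Defs.v *)
From HB Require Import structures.
From mathcomp Require Import all_boot.
From mathcomp Require Import boolp classical_sets.
Set Implicit Arguments.
Unset Strict Implicit.
Unset Printing Implicit Defensive.
Local Open Scope group_scope.
Local Open Scope classical_set_scope.

Reserved Notation "A `*g` B" (at level 46, left associativity).

Definition setMg (M : magmaType) (A B : set M) : set M :=
  [set a * b | a in A & b in B].
Notation "A `*g` B" := (setMg A B) : classical_set_scope.

Record normalSubgroup (G : groupType) := NormalSubgroup {
  nsub_set :> set G;
  nsub_group : group_closed [in nsub_set];
  nsub_normal : forall a n : G, nsub_set n -> nsub_set (a * n * a^-1)
}.

Definition lcosetg (G : groupType) (N : set G) (x : G) : set G :=
  [set x * n | n in N].

Section NormalSubgroupTheory.
Variables (G : groupType) (N : normalSubgroup G).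
Implicit Types x y n : G.

Lemma nsub1 : nsub_set N 1.
Proof. by have [/set_mem] := nsub_group N. Qed.

Lemma nsubV n : nsub_set N n -> nsub_set N n^-1.
Proof. by move=> /mem_set /(group_closedV (nsub_group N)) /set_mem. Qed.

Lemma nsubM m n : nsub_set N m -> nsub_set N n -> nsub_set N (m * n).
Proof.
move=> /mem_set Nm /mem_set Nn; apply: set_mem.
exact: (group_closedM (nsub_group N) Nm Nn).
Qed.

Lemma nsubJ n a : nsub_set N n -> nsub_set N (a^-1 * n * a).
Proof. by move=> /(nsub_normal a^-1); rewrite invgK. Qed.

Lemma lcosetgP x y : lcosetg N x y <-> nsub_set N (x^-1 * y).
Proof.
by split=> [[n Nn <-]|Nxy]; [rewrite mulKg | exists (x^-1 * y) => //; rewrite mulVKg].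
Qed.

Lemma lcosetg_eq x y : lcosetg N x = lcosetg N y <-> nsub_set N (x^-1 * y).
Proof.
split=> [exy|Nxy].
  by apply/lcosetgP; rewrite exy; apply/lcosetgP; rewrite mulVg; exact: nsub1.
apply/seteqP; split=> z /lcosetgP Nz; apply/lcosetgP.
  by have := nsubM (nsubV Nxy) Nz; rewrite invgM invgK -mulgA mulVKg.
by have := nsubM Nxy Nz; rewrite -mulgA mulVKg.
Qed.

Lemma lcosetgM x y : lcosetg N x `*g` lcosetg N y = lcosetg N (x * y).
Proof.
apply/seteqP; split=> [_ [_ [m Nm <-] [_ [n Nn <-] <-]]|_ [n Nn <-]].
  exists (y^-1 * m * y * n); first exact/nsubM/Nn/nsubJ.
  by rewrite !mulgA mulgK.
exists x; first by exists 1; [exact: nsub1 | rewrite mulg1].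
by exists (y * n); [exists n | rewrite mulgA].
Qed.

Lemma lcosetgV x : [set z^-1 | z in lcosetg N x] = lcosetg N x^-1.
Proof.
apply/seteqP; split=> [_ [_ [n Nn <-] <-]|_ [n Nn <-]].
  by apply/lcosetgP; rewrite invgK invgM mulgA; exact/nsub_normal/nsubV.
exists (n^-1 * x); last by rewrite invgM invgK.
by apply/lcosetgP; rewrite mulgA; exact/nsubJ/nsubV.
Qed.

End NormalSubgroupTheory.

(* The quotient group G/N: its elements are the cosets xN, as subsets of G. *)
Definition quot (G : groupType) (N : normalSubgroup G) : Type :=
  set_type (range (lcosetg N)).

Section QuotientGroup.
Variables (G : groupType) (N : normalSubgroup G).

HB.instance Definition _ := gen_eqMixin (quot N).
HB.instance Definition _ := gen_choiceMixin (quot N).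

Definition coset (x : G) : quot N :=
  exist (fun C => C \in range (lcosetg N)) _ (mem_set (imageT (lcosetg N) x)).

Lemma cosetP (X : quot N) : exists x, X = coset x.
Proof. by have [x _ exX] := set_mem (valP X); exists x; apply: val_inj. Qed.

Fact quot_mul_subproof (X Y : quot N) :
  val X `*g` val Y \in range (lcosetg N).
Proof.
have [x ->] := cosetP X; have [y ->] := cosetP Y.
by apply/mem_set; exists (x * y); rewrite ?lcosetgM.
Qed.

Fact quot_inv_subproof (X : quot N) :
  [set z^-1 | z in val X] \in range (lcosetg N).
Proof.
by have [x ->] := cosetP X; apply/mem_set; exists x^-1; rewrite ?lcosetgV.
Qed.

Definition quot_mul (X Y : quot N) : quot N :=
  exist (fun C => C \in range (lcosetg N)) _ (quot_mul_subproof X Y).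

Definition quot_inv (X : quot N) : quot N :=
  exist (fun C => C \in range (lcosetg N)) _ (quot_inv_subproof X).

Fact quot_mulE x y : quot_mul (coset x) (coset y) = coset (x * y).
Proof. by apply: val_inj; exact: lcosetgM. Qed.

Fact quot_invE x : quot_inv (coset x) = coset x^-1.
Proof. by apply: val_inj; exact: lcosetgV. Qed.

Fact quot_mulA : associative quot_mul.
Proof.
move=> X Y Z; have [x ->] := cosetP X; have [y ->] := cosetP Y.
by have [z ->] := cosetP Z; rewrite !quot_mulE mulgA.
Qed.

Fact quot_mul1 : left_id (coset 1) quot_mul.
Proof. by move=> X; have [x ->] := cosetP X; rewrite quot_mulE mul1g. Qed.

Fact quot_1mul : right_id (coset 1) quot_mul.
Proof. by move=> X; have [x ->] := cosetP X; rewrite quot_mulE mulg1. Qed.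

Fact quot_mulV : left_inverse (coset 1) quot_inv quot_mul.
Proof.
by move=> X; have [x ->] := cosetP X; rewrite quot_invE quot_mulE mulVg.
Qed.

Fact quot_Vmul : right_inverse (coset 1) quot_inv quot_mul.
Proof.
by move=> X; have [x ->] := cosetP X; rewrite quot_invE quot_mulE mulgV.
Qed.

HB.instance Definition _ := isGroup.Build (quot N)
  quot_mulA quot_mul1 quot_1mul quot_mulV quot_Vmul.

Lemma cosetM x y : coset (x * y) = coset x * coset y.
Proof. by rewrite -quot_mulE. Qed.

Lemma coset_eq x y : coset x = coset y <-> nsub_set N (x^-1 * y).
Proof.
rewrite -(lcosetg_eq N); split=> [/(congr1 val) //|exy]; exact: val_inj.
Qed.

Definition setquot (H : set G) : set (quot N) := [set coset h | h in H].

Definition theta (X Y : quot N) : Prop :=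
  exists x y : G, [/\ X = coset x, Y = coset y &
    exists a : G, coset x = coset (a * y * a^-1)].

Definition theta_class (X : quot N) : set (quot N) := [set Y | theta Y X].

Definition lowerApr (S : set (quot N)) : set (quot N) :=
  [set X | theta_class X `<=` S].

Definition upperApr (S : set (quot N)) : set (quot N) :=
  [set X | theta_class X `&` S !=set0].

(* Neither theta nor its classes depend on the representatives of the cosets. *)
Lemma thetaE x y :
  theta (coset x) (coset y) <-> exists a, coset x = coset (a * y * a^-1).
Proof.
split=> [[x' [y' [ex ey [a ea]]]]|]; last by exists x, y.
by exists a; rewrite ex ea !cosetM -ey.
Qed.

Lemma theta_classE x :
  theta_class (coset x) = [set coset (a * x * a^-1) | a in setT].
Proof.
apply/seteqP; split=> [Y|_ [a _ <-]]; last by apply/thetaE; exists a.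
by have [y ->] := cosetP Y => /thetaE[a ea]; exists a.
Qed.

End QuotientGroup.

Arguments coset {G} N x.
Arguments setquot {G} N H.

(* Main.v *)
Require Import Defs.
From mathcomp Require Import all_boot.
From mathcomp Require Import boolp classical_sets.
Local Open Scope group_scope.
Local Open Scope classical_set_scope.

(** The relation [theta] is ordinary conjugacy in the group [G/N]
    ([theta_classP]), and conjugation by a fixed element is an automorphism of
    that group. Conjugating a factorization of an element therefore gives a
    factorization of its conjugate, with factors conjugate to the original
    ones. For a member of the upper approximation of [S T], some conjugate
    factors as [s * t], and conjugating back factors the element itself into
    conjugates of [s] and [t]. For a product of members of the lower
    approximations of [S] and [T], every conjugate is a product of a conjugate
    of the first factor, lying in [S], and one of the second, lying in [T].
    These are the inclusions [upperAprM] and [lowerAprM]; the theorem is the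
    case [S = H1/N], [T = H2/N], because [(H1 H2)/N = (H1/N) (H2/N)]
    ([setquotM]). *)

Section Approximations.
Context {G : groupType} {N : normalSubgroup G}.
Implicit Types (X Y : quot N) (S T : set (quot N)).

(** The projection onto [G/N] is surjective, so conjugating by representatives
    in [G] amounts to conjugating by arbitrary elements of [G/N]. *)
Lemma theta_classP X Y : theta_class X Y <-> exists A : quot N, Y = X ^ A.
Proof.
have cosetV (a : G) : coset N a^-1 = (coset N a)^-1.
  by rewrite -quot_invE.
have [x ->] := cosetP X; rewrite theta_classE; split=> [[a _ <-]|[A ->]].
  by exists (coset N a^-1); rewrite conjgE !cosetM !cosetV invgK mulgA.
have [a ->] := cosetP A; exists a^-1 => //.
by rewrite conjgE invgK !cosetM cosetV mulgA.
Qed.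

Lemma setquotM (H1 H2 : set G) :
  setquot N (H1 `*g` H2) = setquot N H1 `*g` setquot N H2.
Proof.
apply/seteqP; split.
  move=> _ [_ [h1 Hh1 [h2 Hh2 <-]] <-]; rewrite cosetM.
  by exists (coset N h1); [exists h1 | exists (coset N h2) => //; exists h2].
move=> _ [_ [h1 Hh1 <-] [_ [h2 Hh2 <-] <-]].
by exists (h1 * h2); [exists h1 => //; exists h2 | rewrite cosetM].
Qed.

Lemma upperAprM S T :
  upperApr (S `*g` T) `<=` upperApr S `*g` upperApr T.
Proof.
have upperJ (U : set (quot N)) u A : U u -> upperApr U (u ^ A).
  move=> Uu; exists u; split=> //; apply/theta_classP.
  by exists A^-1; rewrite conjgK.
move=> X [Y [/theta_classP[A eYA] [s Ss [t Tt est]]]].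
exists (s ^ A^-1); first exact: upperJ.
exists (t ^ A^-1); first exact: upperJ.
by rewrite -conjMg est eYA conjgK.
Qed.

Lemma lowerAprM S T :
  lowerApr S `*g` lowerApr T `<=` lowerApr (S `*g` T).
Proof.
move=> _ [X lowX [Y lowY <-]] _ /theta_classP[A ->]; rewrite conjMg.
exists (X ^ A); first by apply/lowX/theta_classP; exists A.
by exists (Y ^ A) => //; apply/lowY/theta_classP; exists A.
Qed.

End Approximations.

Theorem theorem2p12 (G : groupType) (N : normalSubgroup G) (H1 H2 : set G)
    (H1_neq0 : H1 !=set0) (H2_neq0 : H2 !=set0)
    (NH1 : N `<=` H1) (NH2 : N `<=` H2) :
  upperApr (setquot N (H1 `*g` H2))
    `<=` upperApr (setquot N H1) `*g` upperApr (setquot N H2) /\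
  lowerApr (setquot N H1) `*g` lowerApr (setquot N H2)
    `<=` lowerApr (setquot N (H1 `*g` H2)).
Proof.
by rewrite setquotM; split; [exact: upperAprM | exact: lowerAprM].
Qed.
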